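(* Let $X$ be a set and let $\lambda\in\mathbf{k}$ (this is the case of a trivial semigroup $\Omega$, consisting of one element). The triple $(\mathbf{k}\mathcal{T}(X),\diamond,B^+)$, together with the map $j_X:X\to\mathbf{k}\mathcal{T}(X)$, $x\mapsto\langle|,x,|\rangle$, is the free Rota-Baxter algebra of weight $\lambda$ on $X$.
   Context: $\mathbf{k}$ is a unitary commutative ring; algebras are unitary associative $\mathbf{k}$-algebras, not necessarily commutative. **Rota-Baxter algebras.** A Rota-Baxter algebra of weight $\lambda$ is an algebra $R$ with a linear operator $P$ such that $P(a)P(b)=P\bigl(P(a)b+aP(b)+\lambda ab\bigr)$ for all $a,b\in R$. Morphisms are (unital) algebra morphisms commuting with the operators. A Rota-Baxter algebra $F$ of weight $\lambda$ with a map $i:X\to F$ is free on $X$ if for every Rota-Baxter algebra $A$ of weight $\lambda$ and every map $g:X\to A$ there is a unique morphism $\bar g:F\to A$ with $\bar g\circ i=g$. **Trees.** $\mathcal{T}(X)$ is the set of angularly $X$-decorated planar rooted trees: planar rooted trees with at least one vertex, where the root and the leaves are edges, and each angle (pair of adjacent incoming edges at a vertex) is decorated by an element of $X$. (These are the $\Omega$-typed angularly decorated planar rooted trees for $\Omega$ trivial; the unique possible decoration of internal edges is dropped.) The symbol $|$ denotes the tree with no vertex ($|\notin\mathcal{T}(X)$). Every $T\in\mathcal{T}(X)$ is written uniquely as $T=\langle T_1,x_1,T_2,x_2,\dots,x_n,T_{n+1}\rangle$, $n\ge0$, where the lowest vertex has branches $T_1,\dots,T_{n+1}\in\mathcal{T}(X)\sqcup\{|\}$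 from left to right and $x_i\in X$ decorates the angle between the $i$-th and $(i+1)$-st incoming edges. The bracket is extended multilinearly when $T_i\neq|$ is replaced by a linear combination of trees. $\mathbf{k}\mathcal{T}(X)$ is the free $\mathbf{k}$-module on $\mathcal{T}(X)$, and $B^+$ is the linear operator on it with $B^+(T)=\langle T\rangle$ for $T\in\mathcal{T}(X)$ (grafting on a new root vertex with a single incoming edge). **Product.** The depth is $\operatorname{dep}(|)=0$ and $\operatorname{dep}(T)=1+\max_i\operatorname{dep}(T_i)$. The bilinear product $\diamond$ is defined on trees by induction on $\operatorname{dep}(T)+\operatorname{dep}(T')$: for $T=\langle T_1,x_1,\dots,x_m,T_{m+1}\rangle$ and $T'=\langle T'_1,y_1,\dots,y_n,T'_{n+1}\rangle$, $$T\diamond T'=\langle T_1,x_1,\dots,x_m,V,y_1,T'_2,\dots,y_n,T'_{n+1}\rangle,$$ where $V=|$ if $T_{m+1}=|=T'_1$; $V=T_{m+1}$ if $T_{m+1}\ne|=T'_1$; $V=T'_1$ if $T_{m+1}=|\neq T'_1$; and $V=B^+(T_{m+1})\diamond T'_1+T_{m+1}\diamond B^+(T'_1)+\lambda\,T_{m+1}\diamond T'_1$ if $T_{m+1}\neq|\neq T'_1$. The unit of $\diamond$ is the one-vertex, one-leaf tree $\langle|\rangle$. *)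

(* Defs.v *)
From HB Require Import structures.
From mathcomp Require Import all_boot ssralg.
From mathcomp Require Import finmap monalg boolp.

Set Implicit Arguments.
Unset Strict Implicit.
Unset Printing Implicit Defensive.

Import GRing.Theory.
Local Open Scope ring_scope.

(* The algType of ssralg excludes the zero algebra (1 != 0 there). Here       *)
(* neither the ground ring nor the algebras are assumed nontrivial, so        *)
(* algebras are built on lmodType and pzRingType.                             *)

Section Algebras.
Variable k : comPzRingType.

Record is_algebra (V : lmodType k) (mul : V -> V -> V) (one : V) : Prop := {
  alg_mulA : associative mul;
  alg_mul1 : left_id one mul;
  alg_mulr1 : right_id one mul;
  alg_mulDl : left_distributive mul +%R;
  alg_mulDr : right_distributive mul +%R;
  alg_scaleAl : forall (c : k) (a b : V), c *: mul a b = mul (c *: a) b;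
  alg_scaleAr : forall (c : k) (a b : V), c *: mul a b = mul a (c *: b)
}.

Record algebra := Algebra {
  alg_lmod : lmodType k;
  alg_mul : alg_lmod -> alg_lmod -> alg_lmod;
  alg_one : alg_lmod;
  algP : is_algebra alg_mul alg_one
}.

Definition alg_sort (A : algebra) : Type := alg_lmod A.

End Algebras.

Coercion alg_sort : algebra >-> Sortclass.

HB.instance Definition _ (k : comPzRingType) (A : algebra k) :=
  GRing.Lmodule.on (alg_sort A).
HB.instance Definition _ (k : comPzRingType) (A : algebra k) :=
  GRing.Zmodule_isPzRing.Build (alg_sort A)
    (alg_mulA (algP A)) (alg_mul1 (algP A)) (alg_mulr1 (algP A))
    (alg_mulDl (algP A)) (alg_mulDr (algP A)).

Record is_rota_baxter (k : comPzRingType) (lambda : k) (A : algebra k)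
    (P : A -> A) : Prop := {
  rb_linear : linear P;
  rb_mul : forall a b : A,
    P a * P b = P (P a * b + a * P b + lambda *: (a * b))
}.

Record rbAlgebra (k : comPzRingType) (lambda : k) := RBAlgebra {
  rb_alg :> algebra k;
  rb_op : rb_alg -> rb_alg;
  rb_opP : is_rota_baxter lambda rb_op
}.

Arguments RBAlgebra {k lambda rb_alg rb_op} rb_opP.

Definition rb_morphism (k : comPzRingType) (lambda : k)
    (A B : rbAlgebra lambda) (f : A -> B) : Prop :=
  [/\ linear f, monoid_morphism f &
      forall a : A, f (rb_op a) = rb_op (f a)].

Definition is_free_rb (k : comPzRingType) (lambda : k) (X : Type)
    (F : rbAlgebra lambda) (i : X -> F) : Prop :=
  forall (A : rbAlgebra lambda) (g : X -> A),
    exists f : F -> A,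
      [/\ rb_morphism f, f \o i =1 g &
          forall f' : F -> A, rb_morphism f' -> f' \o i =1 g -> f' =1 f].

Arguments is_free_rb {k lambda X} F i.

Section Trees.
Variable X : Type.

(* A branch is an [option tree], [None] standing for the vertexless tree |.   *)
(* [Node T1 [:: (x1, T2); ...; (xn, Tn+1)]] is <T1, x1, T2, ..., xn, Tn+1>.   *)
Inductive tree : Type := Node of option tree & seq (X * option tree).

HB.instance Definition _ := gen_eqMixin tree.
HB.instance Definition _ := gen_choiceMixin tree.

Local Notation branch := (option tree).

Fixpoint dep (T : tree) : nat :=
  let depb (b : branch) := if b is Some t then dep t else 0%N in
  let: Node b s := T in
  (maxn (depb b) (foldr (fun p => maxn (depb p.2)) 0%N s)).+1.

Definition first_branch (T : tree) : branch := let: Node b _ := T in b.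

Definition last_branch (T : tree) : branch :=
  let: Node b s := T in last b (unzip2 s).

Fixpoint set_last (b : branch) (s : seq (X * branch)) (V : branch) :
    branch * seq (X * branch) :=
  if s is (x, c) :: s' then
    let: (c', s'') := set_last c s' V in (b, (x, c') :: s'')
  else (V, [::]).

(* <T_1, x_1, ..., x_m, V, y_1, T'_2, ..., y_n, T'_(n+1)>: the last branch of *)
(* T and the first branch of T' are discarded and V takes their place.        *)
Definition splice (T : tree) (V : branch) (T' : tree) : tree :=
  let: Node b s := T in let: Node _ s' := T' in
  let: (b', s'') := set_last b s V in Node b' (s'' ++ s').

Definition graft (T : tree) : tree := Node (Some T) [::].

Lemma dep_first T t : first_branch T = Some t -> (dep t < dep T)%N.
Proof. by case: T => b s /= ->; rewrite ltnS leq_maxl. Qed.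

Lemma dep_last T t : last_branch T = Some t -> (dep t < dep T)%N.
Proof.
case: T => b s /= bt; rewrite ltnS.
elim: s b bt => [|[x c] s IHs] b /= => [->|/IHs]; first exact: leq_maxl.
by move=> le_t; rewrite (leq_trans le_t) ?leq_maxr.
Qed.

Lemma dep_graft T : dep (graft T) = (dep T).+1.
Proof. by rewrite /= maxn0. Qed.

End Trees.

Arguments Node {X}.

Section FreeModule.
Variables (k : comPzRingType) (X : Type).

(* The module structure that monalg puts on {malg k[_]} requires k to be      *)
(* nontrivial, hence the alias.                                               *)
Definition kTree : Type := {malg k[tree X]}.

HB.instance Definition _ := GRing.Zmodule.on kTree.

Definition kTree_scale (c : k) (u : kTree) : kTree :=
  \sum_(T <- msupp u) << c * u@_T *g T >>.

Lemma kTree_scaleE c u T : (kTree_scale c u)@_T = c * u@_T.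
Proof.
rewrite {2}[u]monalgE !raddf_sum mulr_sumr /=.
by apply/eq_bigr=> U _; rewrite !mcoeffU mulrnAr.
Qed.

Fact kTree_scaleA a b u : kTree_scale a (kTree_scale b u) = kTree_scale (a * b) u.
Proof. by apply/malgP=> T; rewrite !kTree_scaleE mulrA. Qed.

Fact kTree_scale1 : left_id 1 kTree_scale.
Proof. by move=> u; apply/malgP=> T; rewrite kTree_scaleE mul1r. Qed.

Fact kTree_scaleDr : right_distributive kTree_scale +%R.
Proof.
by move=> a u v; apply/malgP=> T; rewrite !(mcoeffD, kTree_scaleE) mulrDr.
Qed.

Fact kTree_scaleDl u : {morph kTree_scale^~ u : a b / a + b}.
Proof.
by move=> a b; apply/malgP=> T; rewrite !(mcoeffD, kTree_scaleE) mulrDl.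
Qed.

HB.instance Definition _ := GRing.Zmodule_isLmodule.Build k kTree
  kTree_scaleA kTree_scale1 kTree_scaleDr kTree_scaleDl.

Definition basis (T : tree X) : kTree := << T >>.

Definition lin_ext (V : lmodType k) (f : tree X -> V) (u : kTree) : V :=
  \sum_(T <- msupp u) u@_T *: f T.

End FreeModule.

Arguments basis {k X}.

Section Product.
Variables (k : comPzRingType) (lambda : k) (X : Type).
Local Notation kT := (kTree k X).

Definition Bplus : kT -> kT := lin_ext (fun T => basis (graft T)).

(* The first argument is fuel: dep T + dep T' is enough, see diamond_treeE.   *)
Fixpoint diamond_rec (n : nat) (T T' : tree X) : kT :=
  if n isn't n'.+1 then 0 else
  match last_branch T, first_branch T' with
  | None, None => basis (splice T None T')
  | Some t, None => basis (splice T (Some t) T')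
  | None, Some t' => basis (splice T (Some t') T')
  | Some t, Some t' =>
      lin_ext (fun V => basis (splice T (Some V) T'))
        (diamond_rec n' (graft t) t' + diamond_rec n' t (graft t')
         + lambda *: diamond_rec n' t t')
  end.

Definition diamond_tree (T T' : tree X) : kT :=
  diamond_rec (dep T + dep T') T T'.

Definition diamond (u v : kT) : kT :=
  lin_ext (fun T => lin_ext (fun T' => diamond_tree T T') v) u.

Definition one_tree : kT := basis (Node None [::]).

Definition jX (x : X) : kT := basis (Node None [:: (x, None)]).

Lemma diamond_rec_fuel n T T' :
  (dep T + dep T' <= n)%N -> diamond_rec n T T' = diamond_tree T T'.
Proof.
rewrite /diamond_tree => le_n.
move: {2 3}(dep T + dep T')%N (leqnn (dep T + dep T')) => m le_m.
elim: n T T' m le_n le_m => [|n IHn] T T' m; first by case: T.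
case: m => [|m] le_n le_m; first by case: T le_m {le_n}.
rewrite /=; case Dt: (last_branch T) => [t|]; last exact: erefl.
case Dt': (first_branch T') => [t'|]; last exact: erefl.
have lt_t := dep_last Dt; have lt_t' := dep_first Dt'.
have le_sum p a b : (dep T + dep T' <= p.+1)%N -> (a + b < dep T + dep T')%N ->
  (a + b <= p)%N by move=> le_p /leq_trans/(_ le_p).
have l1 : (dep (graft t) + dep t' < dep T + dep T')%N.
  by rewrite dep_graft -addnS leq_add.
have l2 : (dep t + dep (graft t') < dep T + dep T')%N.
  by rewrite dep_graft -addSn leq_add.
have l3 : (dep t + dep t' < dep T + dep T')%N.
  by rewrite -addSn leq_add // ltnW.
by rewrite !(IHn _ _ m) //; apply: le_sum.
Qed.

Lemma diamond_treeE T T' : diamond_tree T T' =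
  match last_branch T, first_branch T' with
  | None, None => basis (splice T None T')
  | Some t, None => basis (splice T (Some t) T')
  | None, Some t' => basis (splice T (Some t') T')
  | Some t, Some t' =>
      lin_ext (fun V => basis (splice T (Some V) T'))
        (diamond_tree (graft t) t' + diamond_tree t (graft t')
         + lambda *: diamond_tree t t')
  end.
Proof.
rewrite -(@diamond_rec_fuel (dep T + dep T').+1); last exact: leqnSn.
rewrite [LHS]/=; case Dt: (last_branch T) => [t|]; last exact: erefl.
case Dt': (first_branch T') => [t'|]; last exact: erefl.
have lt_t := dep_last Dt; have lt_t' := dep_first Dt'.
rewrite !diamond_rec_fuel; [exact: erefl | | |].
- by rewrite leq_add // ltnW.
- by rewrite dep_graft leq_add // ltnW.
- by rewrite dep_graft leq_add // ltnW.
Qed.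

End Product.

(* Main.v *)
From HB Require Import structures.
Require Import Defs.
From mathcomp Require Import all_boot ssralg.
From mathcomp Require Import finmap monalg zify.

(** The product T <*> T' merges the last branch of T with the first branch of
    T', and leaves everything else in place.  The merging itself is a
    k-linear sum over branches, [join_branches]; with it the whole case
    distinction in the definition of the product becomes one formula,
    [diamond_join].  When both branches are trees t and t', the join ranges
    over the terms of
      [rb_bracket t t'] = B+ t <*> t' + t <*> B+ t' + lambda (t <*> t'),
    which is the argument of P on the right of the Rota-Baxter identity.  For
    the one-child trees B+ t and B+ t' the formula is literally this identity,
    so B+ is a Rota-Baxter operator ([Bplus_rota_baxter]).

    Associativity.  If the root of T' carries at least one angle, the two
    junctions of T <*> T' <*> T'' take place in different branches of T', hence
    they commute ([exchange_join_branches]).  If it carries none, both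
    junctions concern the only branch of T', and associativity for
    (T, T', T'') comes down to that of [rb_bracket] on the three branches
    involved.  Expanding with the Rota-Baxter identity turns the latter into
    associativity for seven triples of smaller total depth ([rb_bracketA]), so
    an induction on the depth concludes ([diamondA_basis]).

    Freeness.  A tree <T1, x1, T2, ..., xn, Tn+1> is the product
    W(T1) j(x1) W(T2) ... j(xn) W(Tn+1), where W(|) = 1 and W(T) = B+ T
    otherwise ([basis_cons]).  Hence a morphism is determined by its values on
    X, and has to be the linear extension of [tree_eval], which evaluates this
    word in the target algebra.  It is multiplicative by induction on the
    depth: at a junction of t and t' it sends the join to
    P (P a b + a P b + lambda a b) = P a P b, for a and b the values of t and
    t'. *)

Set Implicit Arguments.
Unset Strict Implicit.
Unset Printing Implicit Defensive.

Import GRing.Theory.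
Local Open Scope ring_scope.

(** * Linear extension from the basis of trees *)

Section LinearExtension.
Variables (k : comPzRingType) (X : Type).
Local Notation kT := (kTree k X).
Implicit Types (V W : lmodType k) (T : tree X) (u : kT).

Lemma lin_extEw V (f : tree X -> V) u (d : {fset tree X}) :
  (msupp u `<=` d)%fset -> lin_ext f u = \sum_(T <- d) u@_T *: f T.
Proof.
move=> sub_d; rewrite /lin_ext (big_fset_incl _ sub_d) // => T _.
by move/mcoeff_outdom=> ->; rewrite scale0r.
Qed.

Lemma lin_ext_is_linear V (f : tree X -> V) : linear (lin_ext (k := k) f).
Proof.
move=> c u v; set d := (msupp (c *: u + v) `|` (msupp u `|` msupp v))%fset.
rewrite !(@lin_extEw _ _ _ d) ?fsubsetUl //; first last.
- exact: fsubset_trans (fsubsetUl _ _) (fsubsetUr _ _).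
- exact: fsubset_trans (fsubsetUr _ _) (fsubsetUr _ _).
rewrite scaler_sumr -big_split /=; apply/eq_bigr=> T _.
by rewrite mcoeffD kTree_scaleE scalerDl scalerA.
Qed.

HB.instance Definition _ V (f : tree X -> V) :=
  GRing.isLinear.Build k kT V *:%R (lin_ext f) (lin_ext_is_linear f).

Lemma lin_ext_basis V (f : tree X -> V) T : lin_ext f (basis T) = f T.
Proof.
rewrite (@lin_extEw _ _ _ [fset T]%fset) ?msuppU_le //.
by rewrite big_seq_fset1 mcoeffUU scale1r.
Qed.

(** Linear maps with no declared structure occur below (partial applications
    of the product, morphisms given by hypotheses), hence the statement with a
    linearity hypothesis. *)
Lemma linear_lin_ext V (f : kT -> V) :
  linear f -> f =1 lin_ext (fun T => f (basis T)).
Proof.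
move=> fL u; pose g : {linear kT -> V} :=
  HB.pack f (GRing.isLinear.Build k kT V *:%R f fL).
rewrite -[f]/(g : kT -> V) {1}[u]monalgE [g _]raddf_sum; apply/eq_bigr=> T _.
rewrite -linearZ; congr (g _); apply/malgP=> U.
by rewrite kTree_scaleE !mcoeffU mulrnAr mulr1.
Qed.

Lemma linear_eq_basis V (f g : kT -> V) : linear f -> linear g ->
  (forall T, f (basis T) = g (basis T)) -> f =1 g.
Proof.
move=> fL gL eq_fg u; rewrite (linear_lin_ext fL) (linear_lin_ext gL).
by apply/eq_bigr=> T _; rewrite eq_fg.
Qed.

Lemma eq_lin_ext V (f g : tree X -> V) :
  f =1 g -> lin_ext (k := k) f =1 lin_ext g.
Proof. by move=> eq_fg u; apply/eq_bigr=> T _; rewrite eq_fg. Qed.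

Lemma linear_comp_lin_ext V W (g : V -> W) (f : tree X -> V) u :
  linear g -> g (lin_ext f u) = lin_ext (fun T => g (f T)) u.
Proof.
move=> gL; have fgL : linear (fun v => g (lin_ext f v)).
  by move=> c v w; rewrite linearP gL.
by rewrite (linear_lin_ext fgL); apply: eq_lin_ext => T; rewrite lin_ext_basis.
Qed.

Lemma exchange_lin_ext V (f : tree X -> tree X -> V) u v :
  lin_ext (fun T => lin_ext (f T) v) u =
  lin_ext (fun T' => lin_ext (f^~ T') u) v.
Proof.
rewrite /lin_ext; under eq_bigr do rewrite scaler_sumr.
rewrite exchange_big; apply/eq_bigr=> T' _ /=; rewrite scaler_sumr.
by apply/eq_bigr=> T _; rewrite !scalerA mulrC.
Qed.

End LinearExtension.

(** * Splicing trees *)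

Section SpliceTrees.
Variable X : Type.
Local Notation branch := (option (tree X)).
Implicit Types (T : tree X) (b V : branch) (s : seq (X * branch)).

Lemma last_set_last b s V : let: (b', s') := set_last b s V in
  last b' (unzip2 s') = V.
Proof.
elim: s b => [|[x c] s IHs] b //=.
by case: (set_last c s V) (IHs c).
Qed.

Lemma set_last_set_last b s U V :
  let: (b', s') := set_last b s U in set_last b' s' V = set_last b s V.
Proof.
elim: s b => [|[x c] s IHs] b //=.
by case: (set_last c s U) (IHs c) => b' s' /= ->.
Qed.

Lemma set_last_cat b s x c s' V : set_last b (s ++ (x, c) :: s') V =
  let: (c', s'') := set_last c s' V in (b, s ++ (x, c') :: s'').
Proof.
elim: s b => [|[y d] s IHs] b //=.
by rewrite IHs; case: (set_last c s' V).
Qed.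

Lemma set_last_last b s : set_last b s (last b (unzip2 s)) = (b, s).
Proof. by elim: s b => [|[x c] s IHs] b //=; rewrite IHs. Qed.

Lemma last_splice_leaf T V b : last_branch (splice T V (Node b [::])) = V.
Proof.
case: T => b1 s1 /=; have:= last_set_last b1 s1 V.
by case: (set_last b1 s1 V) => b' s' /=; rewrite cats0.
Qed.

Lemma splice_leafl T U V b T' :
  splice (splice T U (Node b [::])) V T' = splice T V T'.
Proof.
case: T T' => b1 s1 [b2 s2] /=; have:= set_last_set_last b1 s1 U V.
by case: (set_last b1 s1 U) => b' s' /=; rewrite cats0 => ->.
Qed.

Lemma first_splice_leaf b V T : first_branch (splice (Node b [::]) V T) = V.
Proof. by case: T. Qed.

Lemma splice_leafr T U V b T' :
  splice T V (splice (Node b [::]) U T') = splice T V T'.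
Proof. by case: T T' => b1 s1 []. Qed.

Lemma last_splice_cons T V b x c s :
  last_branch (splice T V (Node b ((x, c) :: s))) = last c (unzip2 s).
Proof.
case: T => b1 s1 /=; case: (set_last b1 s1 V) => b' s' /=.
by rewrite /unzip2 map_cat last_cat.
Qed.

Lemma first_splice_cons b x c s V T :
  first_branch (splice (Node b ((x, c) :: s)) V T) = b.
Proof. by case: T => b1 s1 /=; case: (set_last c s V). Qed.

(** Splicing at the two ends of a tree with an angle acts on two different
    branches; without angle, the two splices would compete for the same one
    ([splice_leafl], [splice_leafr]). *)
Lemma splice_consA T U b x c s V T' :
  splice (splice T U (Node b ((x, c) :: s))) V T' =
  splice T U (splice (Node b ((x, c) :: s)) V T').
Proof.
case: T T' => b1 s1 [b2 s2] /=; case: (set_last b1 s1 U) => b' s' /=.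
by rewrite set_last_cat; case: (set_last c s V) => c' s'' /=; rewrite -catA.
Qed.

(** The generators are the unit, grafting, and the product
    <b> <*> <|, x, |> <*> <c, ...>: this is the induction principle for proving
    that morphisms agree.  The automatic one ignores the trees nested in the
    list of angles. *)
Lemma tree_generation_ind (P : tree X -> Prop) :
  P (Node None [::]) -> (forall T, P T -> P (graft T)) ->
  (forall b x c s, P (Node b [::]) -> P (Node c s) ->
    P (Node b ((x, c) :: s))) ->
  forall T, P T.
Proof.
move=> P1 Pgraft Pcons.
pose Pb (b : branch) := if b is Some t then P t else True.
have Pleaf b : Pb b -> P (Node b [::]) by case: b => [t /Pgraft|].
fix IH 1; case=> b s.
have: Pb b by case: b => [t|]; [exact: IH | exact: I].
elim: s b => [|[x c] s IHs] b Hb; first exact: Pleaf Hb.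
apply: Pcons (Pleaf _ Hb) (IHs c _).
by case: c => [t|]; [exact: IH | exact: I].
Qed.
End SpliceTrees.

(** * The bracket of a Rota-Baxter operator *)

Section RotaBaxterBracket.
Variables (k : comPzRingType) (lambda : k) (V : lmodType k).
Variables (mul : V -> V -> V) (P : V -> V).
Local Notation "u <*> v" := (mul u v) (at level 40).

Hypothesis mulPl : forall c u v w,
  (c *: u + v) <*> w = c *: (u <*> w) + v <*> w.
Hypothesis mulPr : forall w c u v,
  w <*> (c *: u + v) = c *: (w <*> u) + w <*> v.
Hypothesis opP : forall c u v, P (c *: u + v) = c *: P u + P v.

Definition rb_bracket u v : V := P u <*> v + u <*> P v + lambda *: (u <*> v).

Lemma rb_bracketPl c u v w :
  rb_bracket (c *: u + v) w = c *: rb_bracket u w + rb_bracket v w.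
Proof.
rewrite /rb_bracket opP !mulPl !scalerDr !scalerA [lambda * c]mulrC.
by rewrite [RHS]addrACA; congr (_ + _); exact: addrACA.
Qed.

Lemma rb_bracketPr w c u v :
  rb_bracket w (c *: u + v) = c *: rb_bracket w u + rb_bracket w v.
Proof.
rewrite /rb_bracket opP !mulPr !scalerDr !scalerA [lambda * c]mulrC.
by rewrite [RHS]addrACA; congr (_ + _); exact: addrACA.
Qed.

(** Expanding the nested brackets, with the Rota-Baxter identity used to replace
    P of a bracket by a product, gives the same seven words up to
    associativity; these are the products of u or P u by v or P v by w or P w,
    without the word in which P occurs three times. *)
Lemma rb_bracketA u v w :
    (forall a b, P a <*> P b = P (rb_bracket a b)) ->
    (P u <*> P v) <*> w = P u <*> (P v <*> w) ->
    (P u <*> v) <*> P w = P u <*> (v <*> P w) ->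
    (u <*> P v) <*> P w = u <*> (P v <*> P w) ->
    (P u <*> v) <*> w = P u <*> (v <*> w) ->
    (u <*> P v) <*> w = u <*> (P v <*> w) ->
    (u <*> v) <*> P w = u <*> (v <*> P w) ->
    (u <*> v) <*> w = u <*> (v <*> w) ->
  rb_bracket (rb_bracket u v) w = rb_bracket u (rb_bracket v w).
Proof.
move=> rbP e1 e2 e3 e4 e5 e6 e7.
(* Additivity and homogeneity, as rewriting rules, from the combined form. *)
have mulDl a b c : (a + b) <*> c = a <*> c + b <*> c.
  by rewrite -[a]scale1r mulPl !scale1r.
have mulDr a b c : a <*> (b + c) = a <*> b + a <*> c.
  by rewrite -[b]scale1r mulPr !scale1r.
have mul0l c : 0 <*> c = 0.
  by apply: (addrI (0 <*> c)); rewrite -mulDl !addr0.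
have mul0r c : c <*> 0 = 0.
  by apply: (addrI (c <*> 0)); rewrite -mulDr !addr0.
have mulZl x a b : (x *: a) <*> b = x *: (a <*> b).
  by rewrite -[x *: a]addr0 mulPl mul0l addr0.
have mulZr x a b : a <*> (x *: b) = x *: (a <*> b).
  by rewrite -[x *: b]addr0 mulPr mul0r addr0.
rewrite {1}/rb_bracket [RHS]/rb_bracket -!rbP /rb_bracket.
rewrite !(mulDl, mulDr, mulZl, mulZr) e1 e2 e3 e4 e5 e6 e7.
by rewrite !scalerDr !addrA [RHS](ACl (1*2*4*6*3*5*7)%AC).
Qed.
End RotaBaxterBracket.

(** * The product of trees *)

Section Product.
Variables (k : comPzRingType) (lambda : k) (X : Type).
Local Notation kT := (kTree k X).
Local Notation branch := (option (tree X)).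
Local Notation "u <*> v" := (diamond lambda u v) (at level 40).
Local Notation B := (@Bplus k X).
Implicit Types (V W : lmodType k) (T t : tree X) (b : branch) (u v w : kT).

Lemma BplusP c u v : B (c *: u + v) = c *: B u + B v.
Proof. exact: lin_ext_is_linear. Qed.

HB.instance Definition _ := GRing.isLinear.Build k kT kT *:%R B BplusP.

Lemma Bplus_basis T : B (basis T) = basis (graft T).
Proof. exact: lin_ext_basis. Qed.

Lemma diamond_basis T T' : basis T <*> basis T' = diamond_tree lambda T T'.
Proof. by rewrite /diamond !lin_ext_basis. Qed.

Lemma diamondPl c u v w : (c *: u + v) <*> w = c *: (u <*> w) + v <*> w.
Proof. exact: lin_ext_is_linear. Qed.

Lemma diamondPr w c u v : w <*> (c *: u + v) = c *: (w <*> u) + w <*> v.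
Proof.
by rewrite /diamond ![lin_ext _ w]exchange_lin_ext lin_ext_is_linear.
Qed.

HB.instance Definition _ u :=
  GRing.isLinear.Build k kT kT *:%R (diamond lambda u) (diamondPr u).

Lemma diamondDl u v w : (u + v) <*> w = u <*> w + v <*> w.
Proof. exact: (raddfD (lin_ext _)). Qed.

Lemma diamondDr u v w : u <*> (v + w) = u <*> v + u <*> w.
Proof. exact: raddfD. Qed.

Lemma diamondZl c u v : (c *: u) <*> v = c *: (u <*> v).
Proof. exact: (linearZ_LR (lin_ext _)). Qed.

Lemma diamondZr c u v : u <*> (c *: v) = c *: (u <*> v).
Proof. exact: linearZ_LR. Qed.

Local Notation rb_bracket := (rb_bracket lambda (@diamond k lambda X) B).

Lemma diamond_rb_bracketPl c u v w :
  rb_bracket (c *: u + v) w = c *: rb_bracket u w + rb_bracket v w.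
Proof. exact: rb_bracketPl diamondPl BplusP c u v w. Qed.

Lemma diamond_rb_bracketPr w c u v :
  rb_bracket w (c *: u + v) = c *: rb_bracket w u + rb_bracket w v.
Proof. exact: rb_bracketPr diamondPr BplusP w c u v. Qed.

(** [join_branches f b b'] is the linear extension of [f] applied to the formal
    combination V of branches that the product puts at the junction of [b] and
    [b'].  Passing [f] avoids introducing the free module on branches. *)
Definition join_branches V (f : branch -> V) b b' : V :=
  match b, b' with
  | Some t, Some t' =>
      lin_ext (fun U => f (Some U)) (rb_bracket (basis t) (basis t'))
  | Some _, None => f b
  | None, _ => f b'
  end.

Lemma eq_join_branches V (f g : branch -> V) b b' :
  f =1 g -> join_branches f b b' = join_branches g b b'.
Proof.
by move=> eq_fg; case: b b' => [t|] [t'|] //=; apply: eq_lin_ext => U.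
Qed.

Lemma linear_join_branches V W (g : V -> W) (f : branch -> V) b b' : linear g ->
  g (join_branches f b b') = join_branches (fun c => g (f c)) b b'.
Proof.
move=> gL; case: b => [t|]; last exact: erefl.
by case: b' => [t'|]; [exact: linear_comp_lin_ext | exact: erefl].
Qed.

Lemma join_branches_None V (f : branch -> V) b : join_branches f b None = f b.
Proof. by case: b. Qed.

Lemma exchange_join_branches V (f : branch -> branch -> V) b1 b2 b3 b4 :
  join_branches (fun U => join_branches (f U) b3 b4) b1 b2 =
  join_branches (fun U' => join_branches (f^~ U') b1 b2) b3 b4.
Proof.
case: b1 => [t1|//]; case: b2 => [t2|//].
case: b3 => [t3|//]; case: b4 => [t4|//]; exact: exchange_lin_ext.
Qed.

Lemma diamond_join T T' : basis T <*> basis T' =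
  join_branches (fun U => basis (splice T U T'))
    (last_branch T) (first_branch T').
Proof.
rewrite diamond_basis diamond_treeE.
case: (last_branch T) => [t|]; last by case: (first_branch T').
case: (first_branch T') => [t'|]; last exact: erefl.
by rewrite /join_branches /rb_bracket !Bplus_basis !diamond_basis.
Qed.

(** On basis elements this is the recursive clause of the product, read on two
    trees whose root has a single branch. *)
Lemma Bplus_rota_baxter u v : B u <*> B v = B (rb_bracket u v).
Proof.
move: u; apply: linear_eq_basis => [c u1 u2|c u1 u2|t].
- by rewrite BplusP diamondPl.
- by rewrite diamond_rb_bracketPl BplusP.
move: v; apply: linear_eq_basis => [c v1 v2|c v1 v2|t'].
- by rewrite BplusP diamondPr.
- by rewrite diamond_rb_bracketPr BplusP.
by rewrite !Bplus_basis diamond_join.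
Qed.

Lemma diamond_one_l u : one_tree k X <*> u = u.
Proof.
move: u; apply: linear_eq_basis => [||T] //; first exact: diamondPr.
by rewrite diamond_join /=; case: T => [[t|] s].
Qed.

Lemma diamond_one_r u : u <*> one_tree k X = u.
Proof.
move: u; apply: linear_eq_basis => [||T] //.
  by move=> c u v; exact: diamondPl.
rewrite diamond_join join_branches_None; case: T => b s /=.
by rewrite set_last_last cats0.
Qed.

Lemma join_branches_diamondl (f : branch -> kT) b b' w :
  join_branches f b b' <*> w = join_branches (fun c => f c <*> w) b b'.
Proof.
apply: (linear_join_branches (g := fun u => u <*> w)) => c u v.
exact: diamondPl.
Qed.

Lemma join_branches_diamondr (f : branch -> kT) b b' w :
  w <*> join_branches f b b' = join_branches (fun c => w <*> f c) b b'.
Proof. exact: linear_join_branches (diamondPr w). Qed.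

(** When one of the branches is [|], both sides are a single join of the other
    two; the bracket matters only for three trees. *)
Lemma join_branchesA V (f : branch -> V) b b' b'' :
    (forall t t' t'', b = Some t -> b' = Some t' -> b'' = Some t'' ->
       rb_bracket (rb_bracket (basis t) (basis t')) (basis t'') =
       rb_bracket (basis t) (rb_bracket (basis t') (basis t''))) ->
  join_branches (fun U => join_branches f U b'') b b' =
  join_branches (fun U => join_branches f b U) b' b''.
Proof.
case: b => [t|] brA; last exact: erefl.
case: b'' brA => [t''|] brA; last first.
  rewrite join_branches_None; apply: eq_join_branches => c.
  exact: join_branches_None.
case: b' brA => [t'|_]; last by [].
move=> /(_ t t' t'' erefl erefl erefl) brA.
pose g : {linear kT -> V} := lin_ext (fun U => f (Some U)).
have gl : linear (fun u => g (rb_bracket u (basis t''))).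
  by move=> c u v; rewrite diamond_rb_bracketPl linearP.
have gr : linear (fun u => g (rb_bracket (basis t) u)).
  by move=> c u v; rewrite diamond_rb_bracketPr linearP.
transitivity (g (rb_bracket (rb_bracket (basis t) (basis t')) (basis t''))).
  exact/esym/(linear_lin_ext gl).
by rewrite brA; apply: (linear_lin_ext gr).
Qed.

Lemma diamondA_basis T T' T'' :
  (basis T <*> basis T') <*> basis T'' = basis T <*> (basis T' <*> basis T'').
Proof.
have [n] := ubnP (dep T + dep T' + dep T'')%N.
elim: n T T' T'' => [|n IHn] T T' T'' le_n.
  by rewrite ltn0 in le_n; discriminate.
rewrite [basis T <*> _]diamond_join [basis T' <*> _]diamond_join.
rewrite join_branches_diamondl join_branches_diamondr.
case: T' le_n => b' [|[x c] s] le_n; last first.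
  (* The root of T' has an angle: the junctions are independent sums. *)
  transitivity (join_branches (fun U => join_branches
      (fun U' => basis (splice T U (splice (Node b' ((x, c) :: s)) U' T'')))
      (last c (unzip2 s)) (first_branch T'')) (last_branch T) b').
    apply: eq_join_branches => U; rewrite diamond_join last_splice_cons.
    by apply: eq_join_branches => U'; rewrite splice_consA.
  rewrite exchange_join_branches.
  by apply: eq_join_branches => U; rewrite diamond_join first_splice_cons.
(* The root of T' has a single branch b', and both junctions act on it. *)
pose f U : kT := basis (splice T U T'').
transitivity (join_branches (fun U => join_branches f U (first_branch T''))
                (last_branch T) b').
  apply: eq_join_branches => U; rewrite diamond_join last_splice_leaf.
  by apply: eq_join_branches => U'; rewrite splice_leafl.
transitivity (join_branches (fun U => join_branches f (last_branch T) U)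
                b' (first_branch T'')); last first.
  apply: eq_join_branches => U; rewrite diamond_join first_splice_leaf.
  by apply: eq_join_branches => U'; rewrite splice_leafr.
apply: join_branchesA => t t' t'' /dep_last lt_t eq_b' /dep_first lt_t''.
have depT' : dep (Node b' [::]) = (dep t').+1 by rewrite eq_b' dep_graft.
rewrite depT' in le_n.
apply: rb_bracketA; rewrite ?Bplus_basis;
  try exact: diamondPl; try exact: diamondPr; try exact: BplusP;
  try exact: Bplus_rota_baxter.
all: apply: IHn; rewrite ?dep_graft; move: le_n lt_t lt_t''.
all: by move: (dep T) (dep T'') (dep t) (dep t') (dep t'') => *; lia.
Qed.

Lemma diamondA : associative (@diamond k lambda X).
Proof.
move=> u v w.
move: u; apply: linear_eq_basis => [||T];
  try by move=> c a b; rewrite !diamondPl.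
move: v; apply: linear_eq_basis => [||T'].
- by move=> c a b; rewrite diamondPl diamondPr.
- by move=> c a b; rewrite diamondPr diamondPl.
move: w; apply: linear_eq_basis => [||T''];
  try by move=> c a b; rewrite !diamondPr.
exact/esym/diamondA_basis.
Qed.

Lemma diamond_is_algebra : is_algebra (@diamond k lambda X) (@one_tree k X).
Proof.
split; [exact: diamondA | exact: diamond_one_l | exact: diamond_one_r |..].
- by move=> u v w; exact: diamondDl.
- by move=> u v w; exact: diamondDr.
- by move=> c u v; rewrite diamondZl.
- by move=> c u v; rewrite diamondZr.
Qed.

Lemma Bplus_is_rota_baxter :
  is_rota_baxter lambda (A := Algebra diamond_is_algebra) B.
Proof. by split; [exact: BplusP | exact: Bplus_rota_baxter]. Qed.

(** Trees are words in the generators; [<b>] is the unit or a grafted tree. *)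
Lemma basis_cons b x c s : basis (Node b ((x, c) :: s)) =
  (basis (Node b [::]) <*> jX k x) <*> basis (Node c s) :> kT.
Proof.
have -> : basis (Node b [::]) <*> jX k x = basis (Node b [:: (x, None)]) :> kT.
  by rewrite diamond_join join_branches_None.
by rewrite diamond_join.
Qed.


(** * Evaluation of trees in a Rota-Baxter algebra *)

Section Evaluation.
Variables (A : rbAlgebra lambda) (g : X -> A).

Fixpoint tree_eval (T : tree X) : A :=
  let eval_branch (b : branch) :=
    if b is Some t then rb_op (tree_eval t) else 1 in
  let: Node b s := T in
  eval_branch b * foldr (fun p a => g p.1 * (eval_branch p.2 * a)) 1 s.

Definition branch_eval (b : branch) : A :=
  if b is Some t then rb_op (tree_eval t) else 1.

Definition angles_eval (s : seq (X * branch)) : A :=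
  foldr (fun p a => g p.1 * (branch_eval p.2 * a)) 1 s.

Lemma tree_evalE b s : tree_eval (Node b s) = branch_eval b * angles_eval s.
Proof. exact: erefl. Qed.

(** Splicing acts on the last factor of the word of [T] only: the value [a] of
    the others depends neither on the new branch nor on what follows it. *)
Lemma tree_eval_splice T : exists a, forall U b s,
  tree_eval (splice T U (Node b s)) = a * branch_eval U * angles_eval s.
Proof.
case: T => b1 s1; elim: s1 b1 => [|[x c] s1 IHs] b1.
  by exists 1 => U b s; rewrite mul1r.
have [a Ha] := IHs c; exists (branch_eval b1 * (g x * a)) => U b s.
move: (Ha U b s); rewrite /splice /=.
case: (set_last c s1 U) => c' s' /= {}Ha.
by rewrite -!mulrA; congr (_ * (_ * _)); rewrite mulrA -Ha.
Qed.

Lemma splice_last T b : splice T (last_branch T) (Node b [::]) = T.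
Proof. by case: T => b1 s1; rewrite /splice /= set_last_last cats0. Qed.

Lemma tree_eval_graft T : tree_eval (graft T) = rb_op (tree_eval T).
Proof. exact: mulr1. Qed.

Definition rb_lift (u : kT) : A := lin_ext tree_eval u.

Lemma rb_liftP : linear rb_lift.
Proof. exact: lin_ext_is_linear. Qed.

Lemma rb_liftD u v : rb_lift (u + v) = rb_lift u + rb_lift v.
Proof. exact: (raddfD (lin_ext tree_eval)). Qed.

Lemma rb_liftZ c u : rb_lift (c *: u) = c *: rb_lift u.
Proof. exact: (linearZ_LR (lin_ext tree_eval)). Qed.

Lemma rb_lift_basis T : rb_lift (basis T) = tree_eval T.
Proof. exact: lin_ext_basis. Qed.

Lemma rb_lift_Bplus u : rb_lift (B u) = rb_op (rb_lift u).
Proof.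
move: u; apply: linear_eq_basis => [c u v|c u v|T].
- by rewrite BplusP rb_liftP.
- by rewrite rb_liftP (rb_linear (rb_opP A)).
by rewrite Bplus_basis !rb_lift_basis /= mulr1.
Qed.

Lemma alg_mulPl (c : k) (a b d : A) : (c *: a + b) * d = c *: (a * d) + b * d.
Proof. by rewrite mulrDl; congr (_ + _); rewrite (alg_scaleAl (algP A)). Qed.

Lemma alg_mulPr (c : k) (a b d : A) : d * (c *: a + b) = c *: (d * a) + d * b.
Proof. by rewrite mulrDr; congr (_ + _); rewrite (alg_scaleAr (algP A)). Qed.

Lemma rb_lift_diamond_basis T T' :
  rb_lift (basis T <*> basis T') = tree_eval T * tree_eval T'.
Proof.
have [n] := ubnP (dep T + dep T')%N.
elim: n T T' => [|n IHn] T T' le_n.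
  by rewrite ltn0 in le_n; discriminate.
have [a Ha] := tree_eval_splice T.
case: T' le_n => b' s' le_n.
rewrite diamond_join (linear_join_branches _ _ _ rb_liftP).
(* Both words have the same factors outside the junction. *)
transitivity
  (a * join_branches branch_eval (last_branch T) b' * angles_eval s').
  rewrite (linear_join_branches (g := fun y => a * y * angles_eval s')).
    by apply: eq_join_branches => U; rewrite rb_lift_basis Ha.
  by move=> c y z; rewrite alg_mulPr alg_mulPl.
have -> : tree_eval T = a * branch_eval (last_branch T).
  by rewrite -{1}[T](splice_last T None) Ha mulr1.
rewrite tree_evalE.
rewrite -!mulrA; congr (_ * _); rewrite !mulrA; congr (_ * _).
case Dt: (last_branch T) => [t|]; last by rewrite mul1r.
case Dt': b' => [t'|]; last by rewrite mulr1.
have lt_t := dep_last Dt.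
have lt_t' : (dep t' < dep (Node b' s'))%N by apply: dep_first.
have rbL : linear (fun u => rb_op (rb_lift u)).
  by move=> c u v; rewrite rb_liftP (rb_linear (rb_opP A)).
transitivity (rb_op (rb_lift (rb_bracket (basis t) (basis t')))).
  rewrite (linear_lin_ext rbL); apply: eq_lin_ext => U.
  by rewrite rb_lift_basis.
rewrite (rb_mul (rb_opP A)); congr rb_op.
rewrite /rb_bracket !rb_liftD rb_liftZ !Bplus_basis.
have l1 : (dep (graft t) + dep t' < n)%N by rewrite dep_graft; lia.
have l2 : (dep t + dep (graft t') < n)%N by rewrite dep_graft; lia.
have l3 : (dep t + dep t' < n)%N by lia.
rewrite -!tree_eval_graft.
congr (_ + _ + _ *: _); exact: IHn.
Qed.

Lemma rb_lift_diamond u v : rb_lift (u <*> v) = rb_lift u * rb_lift v.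
Proof.
move: u; apply: linear_eq_basis => [c u1 u2|c u1 u2|T].
- by rewrite diamondPl rb_liftP.
- by rewrite rb_liftP alg_mulPl.
move: v; apply: linear_eq_basis => [c v1 v2|c v1 v2|T'].
- by rewrite diamondPr rb_liftP.
- by rewrite rb_liftP alg_mulPr.
by rewrite rb_lift_diamond_basis !rb_lift_basis.
Qed.

Lemma rb_lift_one : rb_lift (one_tree k X) = 1.
Proof. by rewrite rb_lift_basis /= mulr1. Qed.

Lemma rb_lift_jX x : rb_lift (jX k x) = g x.
Proof. by rewrite rb_lift_basis /= mul1r !mulr1. Qed.

Lemma rb_lift_unique (f : kT -> A) :
    linear f -> f (one_tree k X) = 1 -> {morph f : u v / u <*> v >-> u * v} ->
    (forall u, f (B u) = rb_op (f u)) -> (forall x, f (jX k x) = g x) ->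
  f =1 rb_lift.
Proof.
move=> fL f1 fM fB fj; apply: linear_eq_basis fL rb_liftP _ => T.
rewrite rb_lift_basis; elim/tree_generation_ind: T => [|T IHT|b x c s IHb IHs].
- by rewrite f1 /= mulr1.
- by rewrite -Bplus_basis fB IHT /= mulr1.
by rewrite basis_cons !fM fj IHb IHs !tree_evalE /= mulr1 -mulrA.
Qed.

End Evaluation.
End Product.

Theorem corollary2p11 (k : comPzRingType) (lambda : k) (X : Type) :
  exists (Halg : is_algebra (@diamond k lambda X) (@one_tree k X))
         (Hrb : is_rota_baxter lambda (A := Algebra Halg) (@Bplus k X)),
    is_free_rb (RBAlgebra Hrb) (@jX k X).
Proof.
exists (diamond_is_algebra lambda X), (Bplus_is_rota_baxter lambda X) => A g.
exists (rb_lift g); split.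
- split; [exact: rb_liftP | split | exact: rb_lift_Bplus].
  + exact: rb_lift_one.
  + exact: rb_lift_diamond.
- exact: rb_lift_jX.
move=> f [fL [f1 fM] fB] fj.
exact: rb_lift_unique fL f1 fM fB fj.
Qed.
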